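(* Let $f \in \mathbb{C}[x_1,\dots,x_n]_d$ be a homogeneous polynomial of degree $d$ with border Waring rank $\underline{\mathsf{WR}}(f) = r$. Then $\mathsf{WR}(f) \le 4^r \cdot d$.
   Context: $\mathbb{C}[x_1,\dots,x_n]_d$ denotes the space of homogeneous polynomials of degree $d$ over $\mathbb{C}$. The Waring rank $\mathsf{WR}(f)$ is the smallest $r$ such that $f = \sum_{k=1}^r \ell_k^d$ for linear forms $\ell_k \in \mathbb{C}[x_1,\dots,x_n]_1$. The border Waring rank $\underline{\mathsf{WR}}(f)$ is the smallest $r$ such that $f = \lim_{\epsilon\to 0}\sum_{k=1}^r \ell_k(\epsilon)^d$, where each $\ell_k(\epsilon)$ is a linear form in $x_1,\dots,x_n$ whose coefficients are rational functions of $\epsilon$ (equivalently, the smallest $r$ such that $f$ lies in the closure of the set of degree-$d$ forms of Waring rank at most $r$).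
   Formalization: The degree d is assumed to be at least 1; for d = 0 the claim fails, since the constant f = 2 has Waring rank and border Waring rank 2, while the bound 4^2·0 is 0. *)

(* Defs.v *)
From HB Require Import structures.
From mathcomp Require Import all_boot all_order all_algebra.
From mathcomp Require Import reals complex mpoly.
Set Implicit Arguments. Unset Strict Implicit. Unset Printing Implicit Defensive.
Import Order.TTheory GRing.Theory Num.Theory.
Local Open Scope ring_scope.

Section WaringDefs.
Variables (R : realType) (n : nat).
Local Notation C := R[i].

Definition cvgC (u : nat -> C) (l : C) : Prop :=
  forall eps : C, 0 < eps -> exists N : nat, forall k, (N <= k)%N -> `|u k - l| < eps.

Definition waring_le (f : {mpoly C[n]}) (d r : nat) : Prop :=
  exists s : nat, (s <= r)%N /\
    exists l : 'I_s -> {mpoly C[n]},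
      (forall k, l k \is 1.-homog) /\ f = \sum_(k < s) (l k) ^+ d.

Definition border_waring_le (f : {mpoly C[n]}) (d r : nat) : Prop :=
  exists g : nat -> {mpoly C[n]},
    (forall k, waring_le (g k) d r) /\
    forall m : 'X_{1..n}, cvgC (fun k => (g k)@_m) f@_m.

Definition border_waring_rank (f : {mpoly C[n]}) (d r : nat) : Prop :=
  border_waring_le f d r /\ forall r', border_waring_le f d r' -> (r <= r')%N.

End WaringDefs.

(* Main.v *)
(** Write [f] as the limit of sums of [r] powers of linear forms.  The catalecticant
    of [f] has rank at most [r] by semicontinuity, so we may assume that [f] has at
    most [r] variables; if [d < r] it then suffices that powers span the space of forms.
    Otherwise rescale the linear forms and let [u_1, ..., u_r] be limits of their
    coefficient vectors.  A product of derivations [L_1 ... L_r] with each [L_j]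
    orthogonal to the j-th vector kills a sum of [r] powers, so in the limit [f] is
    killed by all [L_1 ... L_r] with [L_j] orthogonal to [u_j].  This forces
    [f = \sum_v v^(d - m_v + 1) G_v], where [v] runs over the distinct points among
    the [u_j], [m_v] is the multiplicity of [v] and [G_v] has degree [m_v - 1].  Now
    [G_v] is a sum of at most [2^(r + m_v - 2)] powers, each [v^a w^b] with [a + b = d]
    is a sum of [d + 1] powers, and [\sum_v 2^(m_v) <= 2^r]. *)

Require Import Defs.
From HB Require Import structures.
From mathcomp Require Import all_boot all_order all_algebra.
From mathcomp Require Import boolp classical_sets filter zify ring.
From mathcomp Require Import reals complex mpoly.
Set Implicit Arguments.
Unset Strict Implicit.
Unset Printing Implicit Defensive.
Import Order.TTheory GRing.Theory Num.Theory.
Local Open Scope ring_scope.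

(** * Derivations *)

Section Derivations.
Variables (C : numFieldType) (n : nat).
Implicit Types (f g h G : {mpoly C[n]}) (L u v w : 'rV[C]_n) (s : seq 'rV[C]_n).

Definition dot L u : C := \sum_i L 0 i * u 0 i.

Definition linform u : {mpoly C[n]} := \sum_i u 0 i *: 'X_i.

Definition dird L f : {mpoly C[n]} := \sum_i L 0 i *: f^`M(i).

(** Apolarity: [f] is annihilated by the product, over [v] in [s], of the ideals generated by the
    derivations orthogonal to [v]. Repetitions in [s] give powers of these ideals. *)
Fixpoint killed s f : Prop :=
  if s is v :: s' then forall L, dot L v = 0 -> killed s' (dird L f) else f = 0.

Fact dird_is_linear L : linear (dird L).
Proof.
move=> a f g; rewrite /dird scaler_sumr -big_split; apply: eq_bigr => i _ /=.
by rewrite linearP /= scalerDr !scalerA mulrC.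
Qed.

HB.instance Definition _ L :=
  GRing.isLinear.Build C {mpoly C[n]} {mpoly C[n]} _ (dird L) (dird_is_linear L).

Lemma dirdDl a L L' f : dird (a *: L + L') f = a *: dird L f + dird L' f.
Proof.
rewrite /dird scaler_sumr -big_split; apply: eq_bigr => i _ /=.
by rewrite !mxE scalerDl scalerA.
Qed.

Lemma dird_delta i f : dird (delta_mx 0 i) f = f^`M(i).
Proof.
rewrite /dird (bigD1 i) //= !mxE !eqxx scale1r big1 ?addr0 // => j ji.
by rewrite !mxE (negbTE ji) andbF scale0r.
Qed.

Lemma dirdC L L' f : dird L (dird L' f) = dird L' (dird L f).
Proof.
have E K K' : dird K (dird K' f) = \sum_i \sum_j (K 0 i * K' 0 j) *: f^`M(j)^`M(i).
  apply: eq_bigr => i _; rewrite (raddf_sum (mderiv i)) scaler_sumr.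
  by apply: eq_bigr => j _ /=; rewrite mderivZ scalerA.
rewrite !E exchange_big; apply: eq_bigr => i _; apply: eq_bigr => j _ /=.
by rewrite mulrC mderiv_comm.
Qed.

Lemma dirdM L f g : dird L (f * g) = dird L f * g + f * dird L g.
Proof.
rewrite /dird mulr_suml mulr_sumr -big_split; apply: eq_bigr => i _ /=.
by rewrite mderivM scalerDr -scalerAl -scalerAr.
Qed.

Lemma dird_linform L u : dird L (linform u) = (dot L u)%:MP.
Proof.
rewrite /dird /linform /dot (raddf_sum (@mpolyC n C)) /=.
apply: eq_bigr => i _; rewrite (raddf_sum (mderiv i)) (bigD1 i) //= big1 ?addr0.
  by rewrite mderivZ mderivX mnm1E eqxx -[X in (X - _)%MM]add0m addmK mpolyX0 scale1r scalerA alg_mpolyC.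
by move=> j ji; rewrite mderivZ mderivX mnm1E (negbTE ji) scale0r scaler0.
Qed.

Lemma dird_exp L u k :
  dird L (linform u ^+ k.+1) = (k.+1%:R * dot L u) *: linform u ^+ k.
Proof.
elim: k => [|k IHk].
  by rewrite expr1 expr0 dird_linform mul1r alg_mpolyC.
rewrite exprS dirdM IHk dird_linform mul_mpolyC -scalerAr -exprS -scalerDl.
by congr (_ *: _); rewrite [in RHS]mulrSr; ring.
Qed.

Lemma linform_homog u : linform u \is 1.-homog.
Proof.
by apply: rpred_sum => i _; apply: rpredZ; rewrite dhomogX /= mdeg1.
Qed.

Lemma linform_exp_homog u k : linform u ^+ k \is k.-homog.
Proof. by rewrite -[X in X.-homog]mul1n; exact/dhomogMn/linform_homog. Qed.

Lemma linformP f : f \is 1.-homog -> f = linform (\row_i f@_(U_(i))).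
Proof.
move=> f1; apply/mpolyP => m; rewrite /linform raddf_sum /=.
have [/eqP /mdeg1P [i /eqP mi]|m1] := eqVneq (mdeg m) 1%N; last first.
  rewrite (dhomog_nemf_coeff f1 m1) big1 // => i _.
  rewrite mcoeffZ mcoeffX; case: eqP => [im|]; last by rewrite mulr0.
  by rewrite -im mdeg1 in m1.
rewrite mi (bigD1 i) //= big1 ?addr0 => [|j ji].
  by rewrite mcoeffZ mcoeffX eqxx mulr1 mxE.
by rewrite mcoeffZ mcoeffX eq_mnm1 (negbTE ji) mulr0.
Qed.

Lemma linformZ a u : linform (a *: u) = a *: linform u.
Proof.
by rewrite /linform scaler_sumr; apply: eq_bigr => i _; rewrite mxE scalerA.
Qed.

Lemma mderiv_homog i d f : f \is d.-homog -> f^`M(i) \is d.-1.-homog.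
Proof.
move=> fd; apply/dhomogP => m; rewrite mcoeff_msupp mcoeff_deriv => fm.
have: f@_(m + U_(i)) != 0 by apply: contraNneq fm => ->; rewrite mul0rn.
rewrite -mcoeff_msupp => /(dhomog_mf fd) /=.
by rewrite mdegD mdeg1 addn1 => <-.
Qed.

Lemma dird_homog L d f : f \is d.-homog -> dird L f \is d.-1.-homog.
Proof.
by move=> fd; apply: rpred_sum => i _; apply/rpredZ/mderiv_homog.
Qed.

Lemma euler d f : f \is d.-homog -> \sum_i 'X_i * f^`M(i) = d%:R *: f.
Proof.
move=> fd.
have XE m : \sum_i 'X_i * ('X_[m])^`M(i) = (mdeg m)%:R *: 'X_[m] :> {mpoly C[n]}.
  rewrite mdegE natr_sum scaler_suml; apply: eq_bigr => i _.
  rewrite mderivX -scalerAr -mpolyXD; have [->|mi] := eqVneq (m i) 0%N.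
    by rewrite !scale0r.
  by rewrite addmC submK //; apply/mnm_lepP => j; rewrite mnm1E; case: eqP => // <-; rewrite lt0n.
rewrite [in LHS](mpolyE f) [in RHS](mpolyE f).
under eq_bigr do rewrite (raddf_sum (mderiv _)) mulr_sumr.
rewrite exchange_big scaler_sumr /= big_seq [RHS]big_seq; apply: eq_bigr => m mf.
rewrite scalerA mulrC -scalerA -(dhomog_mf fd mf) -XE scaler_sumr.
by apply: eq_bigr => i _; rewrite mderivZ scalerAr.
Qed.

Lemma dird_eq0 d f : f \is d.-homog -> (0 < d)%N -> (forall L, dird L f = 0) -> f = 0.
Proof.
move=> fd d0 f0; apply/eqP; have := euler fd.
rewrite big1 => [/esym/eqP|i _]; last by rewrite -dird_delta f0 mulr0.
by rewrite scaler_eq0 pnatr_eq0 eqn0Ngt d0.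
Qed.

Lemma killed0 s : killed s 0.
Proof. by elim: s => //= v s IHs L _; rewrite raddf0. Qed.

Lemma killedP s a f g : killed s f -> killed s g -> killed s (a *: f + g).
Proof.
elim: s f g => /= [|v s IHs] f g; first by move=> -> ->; rewrite scaler0 addr0.
by move=> kf kg L Lv; rewrite linearP; apply: IHs; [apply: kf|apply: kg].
Qed.

Lemma killedZ s a f : killed s f -> killed s (a *: f).
Proof. by move=> /killedP /(_ (killed0 s)) -/(_ a); rewrite addr0. Qed.

Lemma killedD s f g : killed s f -> killed s g -> killed s (f + g).
Proof. by move=> /killedP kf /kf -/(_ 1); rewrite scale1r. Qed.

Lemma killedB s f g : killed s f -> killed s g -> killed s (f - g).
Proof. by move=> kf kg; rewrite -scaleN1r addrC; exact: killedP. Qed.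

Lemma killed_dird s L f : killed s f -> killed s (dird L f).
Proof.
elim: s f => /= [f ->|v s IHs f kf L' L'v]; first by rewrite raddf0.
by rewrite dirdC; apply/IHs/kf.
Qed.

Lemma dotC u v : dot u v = dot v u.
Proof. by apply: eq_bigr => i _; rewrite mulrC. Qed.

Lemma dotDl a L L' u : dot (a *: L + L') u = a * dot L u + dot L' u.
Proof.
rewrite /dot mulr_sumr -big_split; apply: eq_bigr => i _ /=.
by rewrite !mxE mulrDl mulrA.
Qed.

Lemma dotZl a L u : dot (a *: L) u = a * dot L u.
Proof. by rewrite /dot mulr_sumr; apply: eq_bigr => i _; rewrite mxE mulrA. Qed.

Lemma dotZr a L u : dot L (a *: u) = a * dot L u.
Proof. by rewrite dotC dotZl dotC. Qed.

Lemma dot_delta i u : dot (delta_mx 0 i) u = u 0 i.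
Proof.
rewrite /dot (bigD1 i) //= !mxE !eqxx mul1r big1 ?addr0 // => j ji.
by rewrite !mxE (negbTE ji) andbF mul0r.
Qed.

(** The factor attached to [u] annihilates the power; every earlier factor only changes the
    coefficient and lowers the exponent, so the induction runs over all [a] and [e]. *)
Lemma killed_linform_exp s u e a : u \in s -> killed s (a *: linform u ^+ e).
Proof.
elim: s a e => //= v s IHs a e; rewrite inE => uvs L Lv; rewrite linearZ /=.
case: e => [|e].
  rewrite expr0 -mpolyC1 /dird big1 ?scaler0; first exact: killed0.
  by move=> i _; rewrite mderivC scaler0.
rewrite dird_exp scalerA; have [uv|] := eqVneq u v.
  by rewrite uv Lv mulr0 mulr0 scale0r; exact: killed0.
by move=> uv; apply: IHs; move: uvs; rewrite (negbTE uv).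
Qed.

(* A product of [m] derivations vanishes on [h] as soon as one of its factors
   is [L], and every direction is the sum of a multiple of [L] and of an
   element of the hyperplane orthogonal to [u]; so [h] has degree less than [m]. *)
Lemma killed_nseq_inj u m e L h : h \is e.-homog -> (m <= e)%N ->
  killed (nseq m u) h -> dot L u != 0 -> dird L h = 0 -> h = 0.
Proof.
move=> + + + Lu; elim: m e h => [//|m IHm] e h he me kh Lh.
apply: (dird_eq0 he) => [|L']; first by rewrite (leq_trans _ me).
have Wu : dot ((- (dot L' u / dot L u)) *: L + L') u = 0.
  by rewrite dotDl mulNr divfK // addNr.
have : dird ((- (dot L' u / dot L u)) *: L + L') h = 0.
  apply: (IHm e.-1); [exact: dird_homog | by rewrite -ltnS (ltn_predK me) | exact: kh |].
  by rewrite dirdC Lh raddf0.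
by rewrite dirdDl Lh scaler0 add0r.
Qed.

Lemma dird_homog0 L f : f \is 0.-homog -> dird L f = 0.
Proof.
move=> f0; suff -> : f = (f@_0)%:MP by rewrite /dird big1 // => i _; rewrite mderivC scaler0.
apply/mpolyP => m; rewrite mcoeffC; case: eqP => [->|/eqP m0]; first by rewrite mulr1.
by rewrite mulr0 (dhomog_nemf_coeff f0) //= mdeg_eq0.
Qed.

Lemma dird_linform_expM L u a f : dot L u = 0 ->
  dird L (linform u ^+ a * f) = linform u ^+ a * dird L f.
Proof.
move=> Lu; rewrite dirdM; case: a => [|a].
  by rewrite expr0 dird_homog0 ?dhomog1 // mul0r add0r.
by rewrite dird_exp Lu mulr0 scale0r mul0r add0r.
Qed.

(** Derivations orthogonal to [u] treat [linform u] as a constant, so more than [b] of them exhaust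
    the degree of [f]. *)
Lemma killed_linform_expM u a b m f : f \is b.-homog -> (b < m)%N ->
  killed (nseq m u) (linform u ^+ a * f).
Proof.
elim: m b f => // m IHm [|b] f fb bm /= L Lu; rewrite dird_linform_expM //.
  by rewrite dird_homog0 // mulr0; exact: killed0.
by apply: (IHm b) => //; exact: dird_homog fb.
Qed.

(** Integration by parts along [L]: the derivative of [linform u ^+ a.+1 * f] is the wanted
    integrand times [a.+1], plus an error involving [dird L f], which has lower degree and is
    integrated by induction. *)
Lemma dird_linform_integral L u a b f : dot L u = 1 -> f \is b.-homog ->
  exists2 G, G \is b.-homog & dird L (linform u ^+ a.+1 * G) = linform u ^+ a * f.
Proof.
move=> Lu; have a1_neq0 k : k.+1%:R != 0 :> C by rewrite pnatr_eq0.
elim: b a f => [|b IHb] a f fb.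
  exists (a.+1%:R^-1 *: f); first exact: rpredZ.
  rewrite dirdM linearZ /= (dird_homog0 _ fb) scaler0 mulr0 addr0 dird_exp Lu mulr1.
  by rewrite -scalerAl -scalerAr scalerA mulfV // scale1r.
have [G Gb DG] := IHb a.+1 _ (dird_homog L fb).
exists (a.+1%:R^-1 *: (f - linform u * G)).
  by apply/rpredZ/rpredB => //; rewrite -add1n; exact/dhomogM/Gb/linform_homog.
rewrite -scalerAr linearZ /= mulrBr mulrA -exprSr raddfB /= DG dirdM dird_exp Lu mulr1.
by rewrite addrK -scalerAl scalerA mulVf // scale1r.
Qed.

(** Induction on [e - m]: the derivative along [L] is divisible, and integrating it gives a
    divisible form. That form and [f] have the same derivative along [L], hence agree by
    [killed_nseq_inj]. *)
Lemma killed_nseq_divides L u m e f : dot L u = 1 -> f \is e.-homog -> (m <= e)%N ->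
  killed (nseq m.+1 u) f ->
  exists2 G, G \is m.-homog & f = linform u ^+ (e - m) * G.
Proof.
move=> Lu fe /subnKC; move: (e - m)%N => k eE; rewrite -{e}eE in fe *.
elim: k f fe => [|k IHk] f fe kf.
  by rewrite addn0 in fe; exists f => //; rewrite mul1r.
have [||G Gm DG] := IHk (dird L f); last 1 first.
- have [G' G'm DG'] := dird_linform_integral k Lu Gm; exists G' => //.
  have kG' := killed_linform_expM u k.+1 G'm (ltnSn m).
  apply/eqP; rewrite -subr_eq0; apply/eqP.
  apply: (@killed_nseq_inj u m.+1 (m + k.+1) L).
  + by apply: rpredB => //; rewrite addnC; exact/dhomogM/G'm/linform_exp_homog.
  + by rewrite addnS ltnS leq_addr.
  + exact: killedB.
  + by rewrite Lu oner_neq0.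
  + by rewrite raddfB /= DG DG' subrr.
- by rewrite -[(m + k)%N]/((m + k).+1.-1) -addnS; exact: dird_homog.
- exact: killed_dird.
Qed.

Lemma killed_antiderivative L u m e f : dot L u = 1 -> f \is e.-homog ->
  (m <= e.+1)%N -> killed (nseq m u) f ->
  exists G, [/\ G \is e.+1.-homog, killed (nseq m u) G & dird L G = f].
Proof.
move=> Lu fe; case: m => [_ ->|m me kf].
  by exists 0; split; rewrite ?raddf0 ?rpred0.
have [G Gm fE] := killed_nseq_divides Lu fe me kf.
have [G' G'm DG'] := dird_linform_integral (e - m) Lu Gm.
exists (linform u ^+ (e - m).+1 * G'); split; last by rewrite DG' fE.
- have -> : e.+1 = ((e - m).+1 + m)%N by rewrite addSn subnK.
  exact/dhomogM/G'm/linform_exp_homog.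
- exact: killed_linform_expM G'm _.
Qed.

End Derivations.

(** * Decomposition into summands supported at single points *)

Lemma sum_count_mem (T : eqType) (vs s : seq T) : uniq vs -> {subset s <= vs} ->
  (\sum_(v <- vs) count_mem v s = size s)%N.
Proof.
move=> uvs; elim: s => [|x s IHs] sub; first by rewrite big1.
rewrite /= big_split /= IHs => [|y ys]; last by rewrite sub // inE ys orbT.
rewrite -add1n; congr (_ + _)%N; rewrite (bigD1_seq x) ?sub ?mem_head //= eqxx big1 ?addn0 //.
by move=> v; rewrite eq_sym => /negbTE ->.
Qed.

Section Decomposition.
Variables (C : numFieldType) (n : nat).
Implicit Types (f : {mpoly C[n]}) (L u v w : 'rV[C]_n) (s vs : seq 'rV[C]_n).
Implicit Types (h g : 'rV[C]_n -> {mpoly C[n]}).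

(** Distinct members are linearly independent, i.e. represent distinct projective points. *)
Definition separated vs :=
  {in vs &, forall v w, v != w -> exists2 L, dot L v = 0 & dot L w = 1}.

Definition summands (m : 'rV[C]_n -> nat) e h :=
  forall v, h v \is e.-homog /\ killed (nseq (m v) v) (h v).

(** Induction on the total multiplicity. Deriving along an [L] orthogonal to some [v != w] lowers
    both the degree and the multiplicity at [v]; by induction [dird L (h w) = 0], and [L] is not
    orthogonal to [w], so [killed_nseq_inj] applies. *)
Lemma summands_direct vs m e h : separated vs -> uniq vs -> summands m e h ->
  (\sum_(v <- vs) m v <= e.+1)%N -> \sum_(v <- vs) h v = 0 ->
  {in vs, forall v, h v = 0}.
Proof.
move=> sep uvs + + + w wvs.
have [N] := ubnP (\sum_(v <- vs) m v); elim: N m e h => // N IHN m e h leN hm me h0.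
have [mw|mw] := posnP (m w); first by have [_] := hm w; rewrite mw.
have [/hasP [v vvs /andP [vw mv]]|/hasPn nov] :=
  boolP (has (fun v => (v != w) && (0 < m v)%N) vs); last first.
  move: h0; rewrite (bigD1_seq w) //= big_seq_cond big1 ?addr0 // => v /andP [vvs vw].
  have := nov v vvs; rewrite vw /= -eqn0Ngt => /eqP mv.
  by have [_] := hm v; rewrite mv.
have [L Lv Lw] := sep v w vvs wvs vw.
pose m' x := if x == v then (m v).-1 else m x.
have sum_m' : (\sum_(x <- vs) m x = (\sum_(x <- vs) m' x).+1)%N.
  rewrite !(bigD1_seq v vvs uvs) /= {1}/m' eqxx -addSn (prednK mv); congr (_ + _)%N.
  by apply: eq_bigr => x xv; rewrite /m' (negbTE xv).
have sum_vw : (m v + m w <= \sum_(x <- vs) m x)%N.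
  rewrite (bigD1_seq v vvs uvs) leq_add2l big_mkcond (bigD1_seq w wvs uvs) /=.
  by rewrite eq_sym vw leq_addr.
have [hw kw] := hm w.
apply: (killed_nseq_inj hw _ kw (L := L)); [lia|by rewrite Lw oner_neq0|].
apply: (IHN m' e.-1 (fun x => dird L (h x))); [lia| |lia|].
  move=> x; have [hx kx] := hm x; split; first exact: dird_homog.
  rewrite /m'; case: eqP kx => [-> |_]; last exact: killed_dird.
  by case: (m v) mv => //= k _; apply.
by rewrite -raddf_sum h0 raddf0.
Qed.

Definition decomposable vs s e f :=
  exists2 h, summands (fun v => count_mem v s) e h & f = \sum_(v <- vs) h v.

(* If [L] and [L0] are both orthogonal to [u], the two expressions of
   [dird L (dird L0 F)] must agree summand by summand, so that the antiderivative
   of the [w]-summand along [L0] has the correct derivatives along every [L]. *)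
Lemma peel_summands vs s u d f ws : separated vs -> uniq vs ->
  {subset s <= vs} -> u \in vs -> (size s < d)%N -> f \is d.-homog ->
  (forall L, dot L u = 0 -> decomposable vs s d.-1 (dird L f)) ->
  {subset ws <= vs} -> uniq ws -> u \notin ws ->
  exists F h, [/\ F \is d.-homog, summands (fun v => count_mem v s) d h,
    f = F + \sum_(v <- ws) h v &
    forall L, dot L u = 0 -> exists g,
      [/\ summands (fun v => count_mem v s) d.-1 g, {in ws, forall v, g v = 0} &
          dird L F = \sum_(v <- vs) g v]].
Proof.
move=> sep uvs ss uinvs sd fd Df; elim: ws => [|w ws IHws] sws uws uw.
  exists f, (fun=> 0); split=> //; first by move=> v; split; [exact: rpred0|exact: killed0].
    by rewrite big_nil addr0.
  by move=> L /Df [h hs ->]; exists h.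
have wvs : w \in vs by apply: sws; rewrite mem_head.
move: uws uw; rewrite /= inE negb_or => /andP [wws uws] /andP [uw uws'].
have [||//|F [h [Fd hs fE DF]]] := IHws; first by move=> x xws; rewrite sws // inE xws orbT.
  by [].
have [L0 L0u L0w] := sep u w uinvs wvs uw.
have [g0 [g0s _ DF0]] := DF L0 L0u.
have [g0h g0k] := g0s w.
have d0 : (0 < d)%N by rewrite (leq_trans _ sd).
have count_lt v : (count_mem v s <= d.-1)%N.
  by rewrite (leq_trans (count_size _ _)) // -ltnS (prednK d0).
have [G [Gh Gk DG]] := killed_antiderivative L0w g0h (leqW (count_lt w)) g0k.
rewrite (prednK d0) in Gh.
exists (F - G), (fun v => if v == w then G else h v); split.
- exact: rpredB.
- by move=> v; case: eqP => [-> |_]; [split|exact: hs].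
- rewrite big_cons eqxx addrA subrK fE; congr (_ + _).
  by rewrite !big_seq; apply: eq_bigr => v vws; case: eqP => // vw; rewrite -vw vws in wws.
move=> L Lu; have [g [gs g0ws DFL]] := DF L Lu.
have gw : g w = dird L G.
  have [gh gk] := gs w.
  have Gh' : dird L G \is d.-1.-homog by exact: dird_homog.
  apply/eqP; rewrite -subr_eq0; apply/eqP.
  apply: (@killed_nseq_inj _ _ w (count_mem w s) d.-1 L0).
  - exact: rpredB.
  - exact: count_lt.
  - by apply/killedB/killed_dird.
  - by rewrite L0w oner_neq0.
  rewrite raddfB /= (dirdC L0) DG.
  apply: (@summands_direct vs (fun v => count_mem v s) d.-2
    (fun v => dird L0 (g v) - dird L (g0 v))) => //.
  - move=> v; have [hv kv] := gs v; have [hv0 kv0] := g0s v.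
    by split; [apply: rpredB; exact: dird_homog|apply: killedB; exact: killed_dird].
  (* The total multiplicity is [size s], at most [d.-2.+1]; when [d = 1] the truncated [d.-2] is
     harmless because [s] is empty. *)
  - by rewrite sum_count_mem // -ltnS; case: (d) sd => [|[|k]] //= /ltnW.
  by rewrite sumrB -(raddf_sum (dird L0)) -(raddf_sum (dird L)) -DFL -DF0 /= dirdC subrr.
exists (fun v => if v == w then 0 else g v); split.
- by move=> v; case: eqP => [_|_]; [split; [exact: rpred0|exact: killed0]|exact: gs].
- by move=> v; rewrite inE; case: eqP => //= _; exact: g0ws.
rewrite raddfB /= DFL -gw !(bigD1_seq w wvs uvs) /= eqxx add0r [X in X - _]addrC addrK.
by apply: eq_bigr => v /negbTE ->.
Qed.

(** Induction on [s = u :: s']: derivatives of [f] orthogonal to [u] decompose over [s']. Peeling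
    off all points other than [u] leaves [F] whose derivatives orthogonal to [u] are concentrated at
    [u], so [F] is killed by one more copy of [u] than they are. *)
Lemma killed_decomposable vs s d f : separated vs -> uniq vs ->
  {subset s <= vs} -> (size s <= d)%N -> f \is d.-homog -> killed s f ->
  decomposable vs s d f.
Proof.
move=> sep uvs; elim: s d f => [|u s IHs] d f ss sd fd kf.
  exists (fun=> 0) => [v|]; first by split; [exact: rpred0|].
  by rewrite kf big1.
have uinvs : u \in vs by apply: ss; rewrite mem_head.
have ss' : {subset s <= vs} by move=> x xs; rewrite ss // inE xs orbT.
have d0 : (0 < d)%N by rewrite (leq_trans _ sd).
have Df L : dot L u = 0 -> decomposable vs s d.-1 (dird L f).
  move=> Lu; apply: IHs => //; [by rewrite -ltnS (prednK d0)|exact: dird_homog|exact: kf].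
have [| | |F [h [Fd hs fE DF]]] := @peel_summands vs s u d f (rem u vs) sep uvs ss' uinvs sd fd Df.
- by move=> x /mem_rem.
- exact: rem_uniq.
- by rewrite mem_rem_uniq // inE eqxx.
exists (fun v => if v == u then F else h v) => [v|].
  rewrite /=; case: (eqVneq v u) => [->|vu]; last exact: hs.
  split=> //; rewrite add1n /= => L Lu; have [g [gs gws ->]] := DF L Lu.
  rewrite (bigD1_seq u) //= big_seq_cond big1 ?addr0; first by have [] := gs u.
  by move=> w /andP [wvs wu]; apply: gws; rewrite mem_rem_uniq // inE wu.
rewrite fE [RHS](bigD1_seq u) //= eqxx; congr (_ + _).
rewrite (rem_filter _ uvs) big_filter; apply: eq_bigr => v /=.
by move=> /negbTE ->.
Qed.

End Decomposition.

(** * Powers of linear forms *)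

Lemma bin_leq_exp2 N k : ('C(N, k) <= 2 ^ N)%N.
Proof.
elim: N k => [|N IHN] [|k] //; rewrite ?bin0 ?expn_gt0 //.
by rewrite binS expnS mul2n -addnn leq_add.
Qed.

Lemma sum_exp_count_mem (T : eqType) (s : seq T) :
  (\sum_(v <- undup s) 2 ^ count_mem v s <= 2 ^ size s)%N.
Proof.
elim: s => [|x s IHs]; first by rewrite big_nil.
rewrite /= expnS; case: ifPn => xs.
  apply: leq_trans (leq_mul (leqnn 2) IHs); rewrite big_distrr /=.
  by apply: leq_sum => v _; rewrite -expnS leq_pexp2l // -add1n leq_add2r leq_b1.
have -> : (\sum_(v <- x :: undup s) 2 ^ ((x == v) + count_mem v s) =
           2 + \sum_(v <- undup s) 2 ^ count_mem v s)%N.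
  rewrite big_cons eqxx (count_memPn xs); congr (_ + _)%N.
  rewrite !big_seq; apply: eq_bigr => v; rewrite mem_undup => vs.
  by case: eqP xs => // ->; rewrite vs.
(* A new point adds 2, which is bounded by doubling [2 ^ size s] once [s] is nonempty. *)
case: s IHs {xs} => [|y s] IHs; first by rewrite big_nil.
apply: leq_trans (leq_add (leqnn 2) IHs) _.
by rewrite mul2n -addnn leq_add2r; exact: (@leq_pexp2l 2 1).
Qed.

Section Powers.
Variables (C : numFieldType) (n : nat).
Implicit Types (f : {mpoly C[n]}) (u w : 'rV[C]_n).

(** Explicit coefficients make these sums a linear-algebra object over any [C]; over the complex
    numbers they are absorbed by [d]-th roots in [spanned_waring_le]. *)
Definition power_sum d (r : seq (C * 'rV[C]_n)) : {mpoly C[n]} :=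
  \sum_(p <- r) p.1 *: linform p.2 ^+ d.

Definition spanned K d f := exists2 r, (size r <= K)%N & f = power_sum d r.

Lemma spanned0 d : spanned 0 d 0.
Proof. by exists [::] => //; rewrite /power_sum big_nil. Qed.

Lemma spannedD K K' d f g :
  spanned K d f -> spanned K' d g -> spanned (K + K') d (f + g).
Proof.
move=> [r rK ->] [r' rK' ->]; exists (r ++ r'); first by rewrite size_cat leq_add.
by rewrite /power_sum big_cat.
Qed.

Lemma spannedZ K d a f : spanned K d f -> spanned K d (a *: f).
Proof.
move=> [r rK ->]; exists [seq (a * p.1, p.2) | p <- r]; first by rewrite size_map.
by rewrite /power_sum big_map scaler_sumr; apply: eq_bigr => p _; rewrite scalerA.
Qed.

Lemma spanned_sum (I : eqType) (s : seq I) (K : I -> nat) d (F : I -> {mpoly C[n]}) :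
  {in s, forall i, spanned (K i) d (F i)} ->
  spanned (\sum_(i <- s) K i) d (\sum_(i <- s) F i).
Proof.
elim: s => [|i s IHs] sF; first by rewrite !big_nil; exact: spanned0.
rewrite !big_cons; apply: spannedD; first by apply: sF; rewrite mem_head.
by apply: IHs => j js; apply: sF; rewrite inE js orbT.
Qed.

Lemma spanned_leq K K' d f : (K <= K')%N -> spanned K d f -> spanned K' d f.
Proof. by move=> KK' [r rK ->]; exists r => //; exact: leq_trans KK'. Qed.

Lemma linformD u w : linform (u + w) = linform u + linform w.
Proof.
by rewrite /linform -big_split; apply: eq_bigr => i _; rewrite mxE scalerDl.
Qed.

Lemma linform_delta i : linform (delta_mx 0 i) = 'X_i :> {mpoly C[n]}.
Proof.
rewrite /linform (bigD1 i) //= !mxE !eqxx scale1r big1 ?addr0 // => j ji.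
by rewrite !mxE (negbTE ji) andbF scale0r.
Qed.

(* The powers [(u + t w)^d] at the points [t = 0, ..., d] span all the
   [u^(d - b) w^b], by invertibility of the Vandermonde matrix. *)
Lemma linform_expM_spanned u w a b :
  spanned (a + b).+1 (a + b) (linform u ^+ a * linform w ^+ b).
Proof.
set d := (a + b)%N; pose V : 'M[C]_d.+1 := Vandermonde d.+1 (\row_i i%:R).
have bd : (b < d.+1)%N by rewrite ltnS leq_addl.
have V_unit : V \in unitmx.
  rewrite unitmxE det_Vandermonde unitfE prodf_seq_neq0; apply/allP => i _ /=.
  rewrite prodf_seq_neq0; apply/allP => j _; apply/implyP => ij.
  by rewrite !mxE subr_eq0 eqr_nat neq_ltn ij orbT.
(* These weights select the exponent [b] of the parameter [t] and cancel the binomial coefficient in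
   front of it. *)
pose c : 'cV[C]_d.+1 := invmx V *m (('C(d, b))%:R^-1 *: delta_mx (Ordinal bd) 0).
have Vc (j : 'I_d.+1) : \sum_i c i 0 * i%:R ^+ j = ('C(d, b))%:R^-1 * (j == b :> nat)%:R.
  have /matrixP /(_ j 0) : V *m c = ('C(d, b))%:R^-1 *: delta_mx (Ordinal bd) 0.
    by rewrite mulKVmx.
  rewrite !mxE eqxx andbT => <-; apply: eq_bigr => i _.
  by rewrite !mxE mulrC.
have coef (j : 'I_d.+1) :
    \sum_i c i 0 *: (linform u ^+ (d - j) * (i%:R *: linform w) ^+ j *+ 'C(d, j)) =
    ('C(d, b)%:R^-1 * (j == b :> nat)%:R) *: (linform u ^+ (d - j) * linform w ^+ j *+ 'C(d, j)).
  rewrite -Vc scaler_suml; apply: eq_bigr => i _.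
  by rewrite exprZn -scalerAr scalerMnr scalerA.
exists [seq (c i 0, u + i%:R *: w) | i : 'I_d.+1]; first by rewrite size_map size_enum_ord.
have -> : power_sum d [seq (c i 0, u + i%:R *: w) | i : 'I_d.+1] =
    \sum_i c i 0 *: (linform u + i%:R *: linform w) ^+ d.
  by rewrite /power_sum big_map big_enum; apply: eq_bigr => i _; rewrite linformD linformZ.
under eq_bigr => i _ do rewrite exprDn scaler_sumr.
rewrite exchange_big (bigD1 (Ordinal bd)) //= [X in _ + X]big1 ?addr0 => [|j].
  rewrite (coef (Ordinal bd)) /= eqxx mulr1 addnK -scaler_nat scalerA mulVf ?scale1r //.
  by rewrite pnatr_eq0 -lt0n bin_gt0 -ltnS.
rewrite -val_eqE /= => /negbTE jb.
by rewrite coef jb mulr0 scale0r.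
Qed.

Lemma spanned_mul K c b w f : spanned K c f ->
  spanned (K * (b + c).+1) (b + c) (linform w ^+ b * f).
Proof.
move=> [r rK ->]; apply: (@spanned_leq (\sum_(p <- r) (b + c).+1)).
  by rewrite big_const_seq count_predT iter_addn_0 mulnC leq_mul2r rK orbT.
rewrite mulr_sumr; apply: spanned_sum => p _.
by rewrite -scalerAr; exact/spannedZ/linform_expM_spanned.
Qed.

Lemma homog_spanned d f : f \is d.-homog -> exists K, spanned K d f.
Proof.
move=> fd; rewrite (mpolyE f).
have monom (m : 'X_{1..n}) : exists K, spanned K (mdeg m) 'X_[m].
  rewrite mpolyXE_id mdegE; elim/big_rec2: _ => [|i q e _ [K Kq]].
    by exists 1%N, [:: (1, 0)] => //; rewrite /power_sum big_seq1 scale1r.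
  by exists (K * (m i + e).+1)%N; rewrite -linform_delta; exact: spanned_mul.
have : {in msupp f, forall m, mdeg m = d} by exact: dhomog_mf.
elim: (msupp f) => [|m s IHs] sd; first by rewrite big_nil; exists 0%N; exact: spanned0.
have [|K Ks] := IHs; first by move=> m' m's; rewrite sd // inE m's orbT.
have [K' Km] := monom m; exists (K' + K)%N; rewrite big_cons.
by apply/spannedD/Ks/spannedZ; rewrite -(sd m) // mem_head.
Qed.

End Powers.

(** * Counting the powers needed for a form killed by given points *)

Section SpannedBound.
Variables (C : numFieldType) (n : nat).
Implicit Types (f : {mpoly C[n.+1]}) (u w : 'rV[C]_n.+1).

Lemma power_sum_homog k d (r : seq (C * 'rV[C]_k)) : power_sum d r \is d.-homog.
Proof. by apply: rpred_sum => p _; exact/rpredZ/linform_exp_homog. Qed.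

(** Write [f] with any number of powers, then keep a maximal independent subfamily of them: the rank
    of their coefficient matrix is at most the number of monomials of degree [d]. *)
Lemma homog_spanned_bin d f : f \is d.-homog -> spanned 'C(d + n, d) d f.
Proof.
move=> fd; have [K [r _ fr]] := homog_spanned fd.
pose b : seq 'X_{1..n.+1} := [seq s2m t | t : d.-tuple 'I_n.+1 <- enum (basis n.+1 d)].
pose coefs g : 'rV[C]_(size b) := \row_j g@_(nth 0%MM b j).
pose lf i := linform (nth (0, 0) r i).2 ^+ d.
pose A : 'M[C]_(size r, size b) := \matrix_(i, j) (lf i)@_(nth 0%MM b j).
have fA : coefs f = (\row_i (nth (0, 0) r i).1) *m A.
  apply/rowP => j; rewrite !mxE fr /power_sum (big_nth (0, 0)) big_mkord raddf_sum.
  by apply: eq_bigr => i _; rewrite !mxE /= mcoeffZ.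
have /submxP [c cE] : (coefs f <= rowsub (maxrankfun A) A)%MS.
  by rewrite eq_maxrowsub fA submxMl.
exists [seq (c 0 i, (nth (0, 0) r (maxrankfun A i)).2) | i : 'I_(\rank A)].
  by rewrite size_map size_enum_ord -(size_basis n d) rank_leq_col.
apply/mpolyP => m; have [|mb] := boolP (m \in b); last first.
  by rewrite !(@dhomog_nemf_coeff _ _ mdeg d) ?power_sum_homog // basis_cover.
move=> /(nthP 0%MM) [j jb <-].
have /rowP /(_ (Ordinal jb)) := cE; rewrite !mxE /= => ->.
rewrite /power_sum big_map big_enum raddf_sum; apply: eq_bigr => i _ /=.
by rewrite !mxE mcoeffZ.
Qed.

Lemma killed_spanned s d f : (0 < n.+1 <= size s)%N -> (size s <= d)%N ->
  separated s -> {in s, forall v, exists L, dot L v = 1} ->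
  f \is d.-homog -> killed s f -> spanned (4 ^ size s * d) d f.
Proof.
move=> ns sd sep dots fd kf.
have [|||h hs ->] := @killed_decomposable C n.+1 (undup s) s d f _ _ _ sd fd kf.
- by move=> v w; rewrite !mem_undup; exact: sep.
- exact: undup_uniq.
- by move=> v; rewrite mem_undup.
apply: (@spanned_leq _ _ (\sum_(v <- undup s) 2 ^ ((count_mem v s).-1 + n) * d.+1)).
  have d0 : (0 < d)%N by lia.
  (* Since [n.+1 <= size s], each exponent increased by 2 is at most [count_mem v s + size s]. The
     spare factor 4 then absorbs [d.+1 <= 4 * d]. *)
  have le4 : (\sum_(v <- undup s) 2 ^ ((count_mem v s).-1 + n) * 4 <= 4 ^ size s)%N.
    apply: (@leq_trans (2 ^ size s * 2 ^ size s)); last by rewrite -expnMn.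
    apply: leq_trans (leq_mul (sum_exp_count_mem s) (leqnn _)).
    rewrite big_distrl /= !big_seq; apply: leq_sum => v; rewrite mem_undup -has_pred1 has_count.
    move=> c0; rewrite -expnD (_ : 4 = 2 ^ 2)%N // -expnD leq_pexp2l //.
    case/andP: ns => _; move: (size s) (count_mem v s) c0 => k c c0 nk; lia.
  rewrite -big_distrl /=; rewrite -big_distrl /= in le4.
  by nia.
apply: spanned_sum => v; rewrite mem_undup => vs.
have [L Lv] := dots v vs; have [hd kh] := hs v.
have c0 : (0 < count_mem v s)%N by rewrite -has_count has_pred1.
rewrite -(prednK c0) in kh.
have cd : ((count_mem v s).-1 <= d)%N.
  by rewrite (leq_trans (leq_pred _)) // (leq_trans (count_size _ _)).
have [G Gm ->] := killed_nseq_divides Lv hd cd kh.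
apply: (@spanned_leq _ _ ('C((count_mem v s).-1 + n, (count_mem v s).-1) * d.+1)).
  by rewrite leq_mul2r bin_leq_exp2 orbT.
by rewrite -[X in spanned (_ * X.+1) X](subnK cd); apply/spanned_mul/homog_spanned_bin.
Qed.

End SpannedBound.

(** * Limits along an ultrafilter *)

Section FilterLimits.
Variables (C : numFieldType) (U : set_system nat).
Hypothesis UU : UltraFilter U.
Implicit Types (u v : nat -> C) (l : C).

(** An ultrafilter makes all bounded sequences converge simultaneously, replacing successive
    extractions of subsequences. *)
Definition ulim u l := forall eps : C, 0 < eps -> U [set k | `|u k - l| < eps]%classic.

Lemma ulim_cst l : ulim (fun=> l) l.
Proof.
by move=> eps e0; apply: filterS filterT => k _ /=; rewrite subrr normr0.
Qed.

Lemma ulimD u v l l' : ulim u l -> ulim v l' -> ulim (fun k => u k + v k) (l + l').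
Proof.
move=> ul vm eps e0; have e2 : 0 < eps / 2 by rewrite divr_gt0.
apply: filterS (filterI (ul _ e2) (vm _ e2)) => k [/= uk vk].
rewrite opprD addrACA (le_lt_trans (ler_normD _ _)) //.
by rewrite [eps]splitr ltrD.
Qed.

Lemma ulimM u v l l' : ulim u l -> ulim v l' -> ulim (fun k => u k * v k) (l * l').
Proof.
move=> ul vm eps e0; set c := 1 + `|l| + `|l'|.
have c0 : 0 < c by rewrite /c -addrA ltr_pwDl // addr_ge0.
have ec : 0 < eps / c by rewrite divr_gt0.
apply: filterS (filterI (ul _ ltr01) (filterI (ul _ ec) (vm _ ec))) => k [/= u1 [uk vk]].
have -> : u k * v k - l * l' = (u k - l) * (v k - l') + l * (v k - l') + (u k - l) * l' by ring.
have -> : eps = eps / c + `|l| * (eps / c) + (eps / c) * `|l'|.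
  by rewrite -{1}(divfK (lt0r_neq0 c0) eps) /c; ring.
rewrite (le_lt_trans (ler_normD _ _)) // ltr_leD //; last by rewrite normrM ler_wpM2r // ltW.
rewrite (le_lt_trans (ler_normD _ _)) // ltr_leD //; last by rewrite normrM ler_wpM2l // ltW.
by rewrite normrM (le_lt_trans _ vk) // ler_piMl // ltW.
Qed.

Lemma ulim_sum (I : Type) (r : seq I) (P : pred I) (F : I -> nat -> C) (l : I -> C) :
  (forall i, ulim (F i) (l i)) ->
  ulim (fun k => \sum_(i <- r | P i) F i k) (\sum_(i <- r | P i) l i).
Proof.
move=> Fl; elim: r => [|i r IHr].
  by rewrite big_nil; under eq_fun do rewrite big_nil; exact: ulim_cst.
rewrite big_cons; under eq_fun do rewrite big_cons.
by case: ifP => // _; exact: ulimD.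
Qed.

Lemma ulim_prod (I : Type) (r : seq I) (P : pred I) (F : I -> nat -> C) (l : I -> C) :
  (forall i, ulim (F i) (l i)) ->
  ulim (fun k => \prod_(i <- r | P i) F i k) (\prod_(i <- r | P i) l i).
Proof.
move=> Fl; elim: r => [|i r IHr].
  by rewrite big_nil; under eq_fun do rewrite big_nil; exact: ulim_cst.
rewrite big_cons; under eq_fun do rewrite big_cons.
by case: ifP => // _; exact: ulimM.
Qed.

Lemma ulim_cst_eq a l : ulim (fun=> a) l -> l = a.
Proof.
move=> al; apply/eqP; apply: contraT => la.
have d0 : 0 < `|a - l| by rewrite normr_gt0 subr_eq0 eq_sym.
by have [k /=] := filter_ex (al _ d0); rewrite ltxx.
Qed.

(** If [\rank B > r], fixed [X] and [Y] turn [B] into the identity of size [r.+1]. The corresponding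
    determinants vanish along the sequence, while their limit is 1. *)
Lemma ulim_mxrank_le p q r (A : nat -> 'M[C]_(p, q)) (B : 'M[C]_(p, q)) :
  (forall i j, ulim (fun k => A k i j) (B i j)) ->
  (forall k, \rank (A k) <= r)%N -> (\rank B <= r)%N.
Proof.
move=> AB Ar; rewrite leqNgt; apply/negP => rB.
pose X : 'M_(r.+1, p) := pid_mx r.+1 *m invmx (col_ebase B).
pose Y : 'M_(q, r.+1) := invmx (row_ebase B) *m pid_mx r.+1.
have XBY : X *m B *m Y = 1%:M.
  have BE : invmx (col_ebase B) *m B = pid_mx (\rank B) *m row_ebase B.
    by rewrite -[X in _ *m X = _]mulmx_ebase -mulmxA mulKmx ?col_ebase_unit.
  rewrite /X /Y -(mulmxA (pid_mx r.+1)) BE !mulmxA mulmxK ?row_ebase_unit //.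
  have rp := leq_trans rB (rank_leq_row B); have rq := leq_trans rB (rank_leq_col B).
  by rewrite !mul_pid_mx -pid_mx_1; congr (pid_mx _); lia.
have detA k : \det (X *m A k *m Y) = 0.
  apply/eqP; apply: contraT => detA; suff : (r.+1 <= \rank (A k))%N by rewrite ltnNge Ar.
  have /mxrank_unit <- : X *m A k *m Y \in unitmx by rewrite unitmxE unitfE.
  by rewrite (leq_trans (mxrankM_maxl _ _)) // mxrankM_maxr.
have : ulim (fun k => \det (X *m A k *m Y)) (\det (X *m B *m Y)).
  apply: ulim_sum => s; apply: ulimM; first exact: ulim_cst.
  apply: ulim_prod => i; rewrite mxE; under eq_fun do rewrite mxE.
  apply: ulim_sum => j; apply: ulimM; last exact: ulim_cst.
  rewrite mxE; under eq_fun do rewrite mxE.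
  by apply: ulim_sum => h; apply: ulimM; [exact: ulim_cst|exact: AB].
under eq_fun do rewrite detA.
by move=> /ulim_cst_eq; rewrite XBY det1 => /eqP; rewrite oner_eq0.
Qed.

Variable n : nat.
Implicit Types (f : {mpoly C[n]}) (g : nat -> {mpoly C[n]}).

Definition vlim (x : nat -> 'rV[C]_n) (y : 'rV[C]_n) :=
  forall i, ulim (fun k => x k 0 i) (y 0 i).

Definition plim g f := forall m, ulim (fun k => (g k)@_m) f@_m.

Lemma plim_dird (L : nat -> 'rV[C]_n) L' g f :
  vlim L L' -> plim g f -> plim (fun k => dird (L k) (g k)) (dird L' f).
Proof.
move=> LL gf m; rewrite raddf_sum; under eq_fun do rewrite raddf_sum.
apply: ulim_sum => i /=; rewrite mcoeffZ mcoeff_deriv -mulr_natr.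
under eq_fun do rewrite mcoeffZ mcoeff_deriv -mulr_natr.
by apply: ulimM (LL i) _; apply: ulimM (gf _) (ulim_cst _).
Qed.

(* [y 0 a *: L] is the limit of directions orthogonal to the [p.1 k], namely
   the [p.1 k 0 a *: L - dot L (p.1 k) *: delta_mx 0 a]. *)
Lemma killed_ulim (ss : seq ((nat -> 'rV[C]_n) * 'rV[C]_n)) g f :
  {in ss, forall p, vlim p.1 p.2 /\ exists a, p.2 0 a != 0} ->
  (forall k, killed [seq p.1 k | p <- ss] (g k)) -> plim g f ->
  killed [seq p.2 | p <- ss] f.
Proof.
elim: ss g f => [|[x y] ss IHss] g f hs kg gf /=.
  apply/mpolyP => m; rewrite mcoeff0; apply: ulim_cst_eq.
  by have := gf m; under eq_fun do rewrite (kg _) mcoeff0.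
move=> L Ly; have [/= xy [a ya]] := hs (x, y) (mem_head _ _).
pose K k := x k 0 a *: L + (- dot L (x k)) *: delta_mx 0 a.
have KL : vlim K (y 0 a *: L + (- dot L y) *: delta_mx 0 a).
  have dL : ulim (fun k => dot L (x k)) (dot L y).
    by apply: ulim_sum => j; apply: ulimM (ulim_cst _) (xy j).
  move=> i; rewrite !mxE; under eq_fun do rewrite !mxE.
  apply: ulimD; first exact: ulimM (xy a) (ulim_cst _).
  rewrite -mulN1r; under eq_fun do rewrite -mulN1r.
  by apply: ulimM (ulim_cst _); apply: ulimM dL; exact: ulim_cst.
have : killed [seq p.2 | p <- ss] (dird (y 0 a *: L + (- dot L y) *: delta_mx 0 a) f).
  apply: (IHss (fun k => dird (K k) (g k))) (plim_dird KL gf).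
    by move=> p pss; apply: hs; rewrite inE pss orbT.
  move=> k; apply: (kg k) => /=.
  by rewrite dotDl dotZl dot_delta mulNr mulrC subrr.
have dird0 : dird 0 f = 0 by rewrite /dird big1 // => i _; rewrite mxE scale0r.
rewrite Ly oppr0 scale0r dirdDl dird0 addr0 => /(killedZ (y 0 a)^-1).
by rewrite scalerA mulVf // scale1r.
Qed.

End FilterLimits.

(** * Compactness of the complex unit disc *)

Section ComplexLimits.
Variables (R : realType) (U : set_system nat).
Hypothesis UU : UltraFilter U.
Local Notation C := R[i].

(** The limit is the supremum of the [y] that lie below [x k] for [U]-almost all [k]; the upper
    estimate uses that [U] contains any set or its complement. *)
Lemma bounded_real_ulim (x : nat -> R) a b : (forall k, a <= x k <= b) ->
  exists l : R, forall eps : R, 0 < eps -> U [set k | `|x k - l| < eps]%classic.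
Proof.
move=> xab; pose S := [set y | U [set k | y <= x k]]%classic.
have Sa : S a.
  by rewrite /S /=; apply: filterS filterT => k _ /=; case/andP: (xab k).
have Sb y : S y -> y <= b.
  by move=> /filter_ex [k /= yx]; apply: le_trans yx _; case/andP: (xab k).
have supS : has_sup S by split; [exists a|exists b => y /Sb].
exists (sup S) => eps e0; have [y Sy ySe] := sup_adherent e0 supS.
have SeN : U (~` [set k | sup S + eps <= x k])%classic.
  have [Se|//] := in_ultra_setVsetC [set k | sup S + eps <= x k]%classic UU.
  have := sup_upper_bound supS Se.
  by rewrite gerDl leNgt e0.
apply: filterS (filterI Sy SeN) => k [/= yx /negP]; rewrite -ltNge => xS.
by rewrite ltr_distl xS (lt_le_trans ySe).
Qed.

Lemma norm_real_complex (x : R) : `|x%:C%C| = `|x|%:C%C :> C.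
Proof. by rewrite normc_def /= expr0n addr0 sqrtr_sqr. Qed.

Lemma bounded_ulim (u : nat -> C) : (forall k, `|u k| <= 1) -> exists l, ulim U u l.
Proof.
move=> u1.
have part (h : C -> R) : (forall z, `|h z|%:C%C <= `|z|) ->
    exists l : R, ulim U (fun k => (h (u k))%:C%C) l%:C%C.
  move=> hle; have [|l hl] := @bounded_real_ulim (fun k => h (u k)) (-1) 1.
    move=> k; rewrite -ler_norml -lecR; exact: le_trans (hle _) (u1 k).
  exists l => eps e0; have eR := RRe_real (gtr0_real e0).
  have e0' : 0 < complex.Re eps by move: e0; rewrite ltcE => /andP [_].
  apply: filterS (hl _ e0') => k /=.
  by rewrite -(rmorphB (real_complex R)) norm_real_complex -eR ltcR.
have [a ua] := part (@complex.Re R) (@normc_ge_Re R).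
have [|b ub] := part (@complex.Im R).
  move=> z; rewrite -normrN -ReiNIm (le_trans (normc_ge_Re _)) // normrM.
  by rewrite [X in _ * X]normc_def /= expr0n add0r expr1n sqrtr1 mulr1.
exists (a%:C%C + 'i%C * b%:C%C).
have -> : u = fun k : nat => (complex.Re (u k))%:C%C + 'i%C * (complex.Im (u k))%:C%C.
  by apply: funext => k; exact: complexE.
by apply: ulimD ua _; apply: ulimM ub; exact: ulim_cst.
Qed.

End ComplexLimits.

(** * Reduction of the number of variables *)

Section Substitution.
Variable C : numFieldType.

(** As a function this is [y] mapped to [f] evaluated at [M^T y], so that composition of
    substitutions follows the matrix product. *)
Definition subst p q (M : 'M[C]_(q, p)) (f : {mpoly C[p]}) : {mpoly C[q]} :=
  f \mPo [tuple linform (col i M)^T | i < p].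

Lemma subst_mpolyE p q (M : 'M[C]_(q, p)) w f : (msize f <= w)%N ->
  subst M f = \sum_(m : 'X_{1..p < w}) f@_m *: \prod_(i < p) linform (col i M)^T ^+ m i.
Proof.
move=> fw; rewrite /subst (comp_mpolywE _ fw); apply: eq_bigr => m _.
by congr (_ *: _); apply: eq_bigr => i _; rewrite tnth_mktuple.
Qed.

Lemma substX p q (M : 'M[C]_(q, p)) i : subst M 'X_i = linform (col i M)^T.
Proof. by rewrite /subst comp_mpolyXU -tnth_nth tnth_mktuple. Qed.

Lemma subst_linform p q (M : 'M[C]_(q, p)) u : subst M (linform u) = linform (u *m M^T).
Proof.
rewrite /linform {1}/subst raddf_sum /=.
under eq_bigr => i _ do rewrite comp_mpolyZ -/(subst M _) substX /linform scaler_sumr.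
rewrite exchange_big; apply: eq_bigr => j _ /=; rewrite mxE scaler_suml.
by apply: eq_bigr => i _; rewrite !mxE scalerA.
Qed.

Lemma subst_comp p q t (M : 'M[C]_(t, q)) (N : 'M[C]_(q, p)) f :
  subst M (subst N f) = subst (M *m N) f.
Proof.
rewrite [subst N f](subst_mpolyE _ (leqnn _)) [RHS](subst_mpolyE _ (leqnn _)).
rewrite {1}/subst raddf_sum; apply: eq_bigr => m _ /=; rewrite comp_mpolyZ rmorph_prod.
congr (_ *: _); apply: eq_bigr => i _; rewrite rmorphXn /=; congr (_ ^+ _).
by rewrite -/(subst M _) subst_linform -trmx_mul !colE mulmxA.
Qed.

Lemma subst_homog p q (M : 'M[C]_(q, p)) d f : f \is d.-homog -> subst M f \is d.-homog.
Proof.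
move=> /homog_spanned [K [r _ ->]]; rewrite /subst raddf_sum rpred_sum // => a _ /=.
rewrite comp_mpolyZ rpredZ // rmorphXn /= -/(subst M _) subst_linform.
exact: linform_exp_homog.
Qed.

(** Homogeneity bounds all supports uniformly, so each coefficient after substitution is one fixed
    finite linear combination of coefficients before it. *)
Lemma subst_plim U p q (M : 'M[C]_(q, p)) d (g : nat -> {mpoly C[p]}) f :
  UltraFilter U -> (forall k, g k \is d.-homog) -> f \is d.-homog ->
  plim U g f -> plim U (fun k => subst M (g k)) (subst M f).
Proof.
move=> UU gd fd gf m.
have size_homog (h : {mpoly C[p]}) : h \is d.-homog -> (msize h <= d.+1)%N.
  move=> hd; rewrite msizeE; apply/bigmax_leqP_seq => m' m'h _.
  by rewrite ltnS (dhomog_mf hd m'h).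
rewrite (subst_mpolyE _ (size_homog _ fd)) raddf_sum.
under eq_fun do rewrite (subst_mpolyE _ (size_homog _ (gd _))) raddf_sum.
apply: ulim_sum => m'; rewrite /= mcoeffZ; under eq_fun do rewrite mcoeffZ.
exact: ulimM (gf _) (ulim_cst _ _).
Qed.

(* By Euler's identity, induction on the degree. *)
Lemma subst_fixed p (P : 'M[C]_p) d f : f \is d.-homog ->
  (forall j, dird (row j P) f = f^`M(j)) -> subst P f = f.
Proof.
elim: d f => [|d IHd] f fd Pf.
  suff -> : f = (f@_0)%:MP by rewrite /subst comp_mpolyC.
  apply/mpolyP => m; rewrite mcoeffC; case: eqP => [->|/eqP m0]; first by rewrite mulr1.
  by rewrite mulr0 (dhomog_nemf_coeff fd) //= mdeg_eq0.
have d0 : d.+1%:R != 0 :> C by rewrite pnatr_eq0.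
apply: (scalerI d0); transitivity (subst P (\sum_i 'X_i * f^`M(i))).
  by rewrite (euler fd) /subst comp_mpolyZ.
rewrite -[RHS](euler fd) {1}/subst raddf_sum; transitivity (\sum_i subst P 'X_i * f^`M(i)).
  apply: eq_bigr => i _; rewrite /= rmorphM /=; congr (_ * _).
  apply: IHd => [|j]; first exact: (mderiv_homog i fd).
  by rewrite -(dird_delta i f) dirdC Pf !dird_delta mderiv_comm.
under eq_bigr => i _ do rewrite substX mulr_suml.
rewrite exchange_big; apply: eq_bigr => j _ /=; rewrite -Pf mulr_sumr.
by apply: eq_bigr => i _; rewrite !mxE -scalerAl -scalerAr.
Qed.

End Substitution.

(** * Waring rank under substitution, and essential variables *)

Section Waring.
Variable R : realType.
Local Notation C := R[i].

Lemma waring_le_subst p q (M : 'M[C]_(q, p)) (f : {mpoly C[p]}) d r :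
  waring_le f d r -> waring_le (subst M f) d r.
Proof.
move=> [s [sr [l [l1 ->]]]]; exists s; split=> //; exists (fun k => subst M (l k)).
split=> [k|]; first exact: subst_homog.
by rewrite {1}/subst raddf_sum; apply: eq_bigr => k _; rewrite /= rmorphXn.
Qed.

Lemma waring_le_homog n (f : {mpoly C[n]}) d r : waring_le f d r -> f \is d.-homog.
Proof.
move=> [s [_ [l [l1 ->]]]]; apply: rpred_sum => k _.
by rewrite (linformP (l1 k)) linform_exp_homog.
Qed.

Lemma spanned_waring_le n (f : {mpoly C[n]}) d r : (0 < d)%N ->
  spanned r d f -> waring_le f d r.
Proof.
move=> d0 [t tr ->]; exists (size t); split=> //.
exists (fun k => d.-root (nth (0, 0) t k).1 *: linform (nth (0, 0) t k).2); split=> [k|].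
  exact/rpredZ/linform_homog.
rewrite /power_sum (big_nth (0, 0)) big_mkord; apply: eq_bigr => k _.
by rewrite exprZn rootCK.
Qed.

(* The gradient of a sum of [r] powers lies in the span of [r] vectors, and
   matrices of rank at most [r] form a closed set. *)
Lemma essential_variables U n d r (g : nat -> {mpoly C[n]}) (f : {mpoly C[n]}) :
  UltraFilter U -> (forall k, waring_le (g k) d r) -> f \is d.-homog -> (0 < d)%N ->
  plim U g f ->
  exists rho (X : 'M[C]_(n, rho)) (Y : 'M[C]_(rho, n)),
    (rho <= r)%N /\ subst X (subst Y f) = f.
Proof.
move=> UU gr fd d0 gf.
(* Only monomials occurring in the gradient of [f] are recorded; outside [b] all derivatives of [f]
   have zero coefficient. *)
pose b := flatten [seq msupp f^`M(i) | i : 'I_n].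
pose grad h : 'M[C]_(n, size b) := \matrix_(i, j) (h^`M(i))@_(nth 0%MM b j).
have rk_grad : (\rank (grad f) <= r)%N.
  apply: (@ulim_mxrank_le _ U _ _ _ _ (fun k => grad (g k))) => [i j|k].
    rewrite mxE -dird_delta; under eq_fun do rewrite mxE -dird_delta.
    by apply: (plim_dird UU (L := fun=> delta_mx 0 i)) => // i'; exact: ulim_cst.
  have [s [sr [l [l1 gE]]]] := gr k; apply: leq_trans sr.
  pose u j : 'rV[C]_n := \row_i (l j)@_(U_(i)).
  pose A : 'M[C]_(n, s) := \matrix_(i, j) u j 0 i.
  pose B : 'M[C]_(s, size b) :=
    \matrix_(j, h) (d%:R * (linform (u j) ^+ d.-1)@_(nth 0%MM b h)).
  have -> : grad (g k) = A *m B.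
    apply/matrixP => i h; rewrite [LHS]mxE [RHS]mxE gE -dird_delta.
    rewrite (raddf_sum (dird _)) (raddf_sum (mcoeff _)) /=; apply: eq_bigr => j _.
    rewrite [A i j]mxE [B j h]mxE (linformP (l1 j) : l j = linform (u j)).
    by rewrite -{1}(prednK d0) dird_exp mcoeffZ dot_delta (prednK d0) mulrCA mulrA.
  exact: leq_trans (mxrankM_maxr _ _) (rank_leq_row _).
(* [Y] is a left inverse of [col_base (grad f)], so [col_base (grad f) *m Y] fixes [grad f]; read
   row by row, this is the hypothesis of [subst_fixed]. *)
have /row_fullP [Y YX] := col_base_full (grad f).
exists (\rank (grad f)), (col_base (grad f)), Y; split=> //.
rewrite subst_comp; apply: (subst_fixed fd) => j; apply/mpolyP => m.
have gradE (v : 'rV_n) h : (v *m grad f) 0 h = (dird v f)@_(nth 0%MM b h).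
  rewrite mxE raddf_sum; apply: eq_bigr => i _.
  by rewrite !mxE /= mcoeffZ.
have [|mb] := boolP (m \in b); last first.
  have m0 i : (f^`M(i))@_m = 0.
    apply: memN_msupp_eq0; apply: contra mb => mi; apply/flatten_mapP.
    by exists i; rewrite ?mem_enum.
  by rewrite m0 raddf_sum big1 // => i _ /=; rewrite mcoeffZ m0 mulr0.
move=> /(nthP 0%MM) [h hb <-]; rewrite -(gradE _ (Ordinal hb)) -row_mul -mulmxA.
rewrite -[X in Y *m X](mulmx_base (grad f)) (mulmxA Y) YX mul1mx mulmx_base.
by rewrite !mxE.
Qed.

End Waring.

(** * The main bound *)

Section Normalization.
Variables (C : numFieldType) (n : nat).
Implicit Types (v w L : 'rV[C]_n) (s : seq 'rV[C]_n) (f : {mpoly C[n]}).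

Definition pivot v := [pick i | v 0 i != 0].

Definition normalize v := if pivot v is Some i then (v 0 i)^-1 *: v else v.

Definition normalized v := exists2 i, pivot v = Some i & v 0 i = 1.

Lemma pivotZ a v : a != 0 -> pivot (a *: v) = pivot v.
Proof. by move=> a0; apply: eq_pick => i; rewrite mxE mulf_eq0 (negbTE a0). Qed.

Lemma pivot_neq0 v : v != 0 -> exists2 i, pivot v = Some i & v 0 i != 0.
Proof.
rewrite /pivot; case: pickP => [i vi _|v0 /eqP[]]; first by exists i.
by apply/rowP => i; rewrite mxE; apply/eqP/negbFE/v0.
Qed.

Lemma dot_normalize v L : dot L (normalize v) = 0 -> dot L v = 0.
Proof.
have [->|/pivot_neq0 [i vi i0]] := eqVneq v 0.
  by move=> _; rewrite /dot big1 // => i _; rewrite mxE mulr0.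
rewrite /normalize vi dotZr => /eqP.
by rewrite mulf_eq0 invr_eq0 (negbTE i0) => /eqP.
Qed.

Lemma normalize_normalized v : v != 0 -> normalized (normalize v).
Proof.
move=> /pivot_neq0 [i vi i0]; exists i; rewrite /normalize vi ?pivotZ ?invr_eq0 //.
by rewrite mxE mulVf.
Qed.

Lemma normalized_dot v : normalized v -> exists L, dot L v = 1.
Proof. by move=> [i _ vi]; exists (delta_mx 0 i); rewrite dot_delta. Qed.

(** Let [a] be the pivot of [v]. Either some [w 0 i - v 0 i * w 0 a] is nonzero and gives the
    separating functional, or [w] is proportional to [v], hence has the same pivot and equals
    [v]. *)
Lemma normalized_separated s : {in s, forall v, normalized v} -> separated s.
Proof.
move=> ns v w /ns [a va v1] /ns [b wb w1] vw.
have [/existsP [i wi]|/existsPn all0] := boolP [exists i, w 0 i - v 0 i * w 0 a != 0].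
  pose K : 'rV[C]_n := - v 0 i *: delta_mx 0 a + delta_mx 0 i.
  have Ku x : dot K x = x 0 i - v 0 i * x 0 a.
    by rewrite dotDl !dot_delta addrC mulNr.
  exists ((w 0 i - v 0 i * w 0 a)^-1 *: K); rewrite dotZl Ku.
    by rewrite v1 mulr1 subrr mulr0.
  by rewrite mulVf.
have wE : w = w 0 a *: v.
  by apply/rowP => i; apply/eqP; rewrite mxE mulrC -subr_eq0; exact/negbNE/all0.
have wa : w 0 a != 0.
  apply/eqP => wa; move: w1; rewrite wE wa scale0r mxE => /esym/eqP.
  by rewrite oner_eq0.
move: wb; rewrite wE pivotZ // va => -[ab].
by move: vw; rewrite [w in v != w]wE ab w1 scale1r eqxx.
Qed.

Lemma killed_normalize s f : killed s f -> killed [seq normalize v | v <- s] f.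
Proof.
elim: s f => //= v s IHs f kf L Lv; apply/IHs/kf; exact: dot_normalize.
Qed.

End Normalization.

(** * Limits of power sum decompositions and the final bound *)

Section BorderRank.
Variable R : realType.
Local Notation C := R[i].

(** The bound yields limits along an ultrafilter, and the coordinate equal to 1 keeps those limits
    nonzero. *)
Definition bounded_vector n (v : 'rV[C]_n) :=
  (forall i, `|v 0 i| <= 1) /\ exists i, v 0 i = 1.

Lemma rescale_bounded n (v : 'rV[C]_n.+1) :
  exists p : C * 'rV[C]_n.+1, v = p.1 *: p.2 /\ bounded_vector p.2.
Proof.
have [->|v0] := eqVneq v 0.
  exists (0, const_mx 1); split=> /=; first by rewrite scale0r.
  by split=> [i|]; [rewrite mxE normr1|exists 0; rewrite mxE].
have [i _ imax] := @Order.TotalTheory.arg_maxP _ _ 'I_n.+1 0 xpredT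
  (fun i => complex.Re `|v 0 i|) isT.
have le_vi j : `|v 0 j| <= `|v 0 i|.
  by rewrite lecE; apply/andP; split; [rewrite !normc_def|exact: (imax j isT)].
have vi : v 0 i != 0.
  apply: contra_neq v0 => vi; apply/rowP => j; rewrite mxE; apply/eqP.
  by rewrite -normr_le0 -(normr0 C) -vi le_vi.
exists (v 0 i, (v 0 i)^-1 *: v); split=> /=; first by rewrite scalerA mulfV // scale1r.
split=> [j|]; last by exists i; rewrite mxE mulVf.
by rewrite mxE normrM normfV mulrC ler_pdivrMr ?normr_gt0 // mul1r.
Qed.

(** Padding with zero coefficients gives exactly [r] terms, so that the [j]-th direction is defined
    for every member of a sequence. *)
Lemma waring_le_bounded n d r (g : {mpoly C[n.+1]}) : (0 < d)%N -> waring_le g d r ->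
  exists t, [/\ size t = r, g = power_sum d t & {in t, forall p, bounded_vector p.2}].
Proof.
move=> d0 [s [sr [l [l1 ->]]]]; have /choice [F FP] := @rescale_bounded n.
pose u k : 'rV[C]_n.+1 := \row_i (l k)@_(U_(i)).
have [_ bF0] := FP 0.
pose t := [seq ((F (u k)).1 ^+ d, (F (u k)).2) | k : 'I_s].
have tE : \sum_(k < s) l k ^+ d = \sum_(p <- t) p.1 *: linform p.2 ^+ d.
  rewrite big_map big_enum; apply: eq_bigr => k _; have [uF _] := FP (u k).
  by rewrite (linformP (l1 k)) -/(u k) {1}uF linformZ exprZn.
exists (t ++ nseq (r - s) (0, (F 0).2)); split.
- by rewrite size_cat size_map size_enum_ord size_nseq subnKC.
- rewrite /power_sum big_cat /= -tE [X in _ + X]big_seq [X in _ + X]big1 ?addr0 //.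
  by move=> p /nseqP [-> _]; rewrite scale0r.
move=> p; rewrite mem_cat => /orP [/mapP [k _ ->]|/nseqP [-> _]] //.
by have [] := FP (u k).
Qed.

(** Only the rescaled directions need to converge: the coefficients may diverge, but [killed] does
    not see them. *)
Lemma border_killed U n d r (g : nat -> {mpoly C[n.+1]}) (f : {mpoly C[n.+1]}) :
  UltraFilter U -> (0 < d)%N -> (forall k, waring_le (g k) d r) -> plim U g f ->
  exists s, [/\ size s = r, {in s, forall v, v != 0} & killed s f].
Proof.
move=> UU d0 gr gf.
have /choice [t tP] := fun k => waring_le_bounded d0 (gr k).
pose x j k := (nth (0, 0) (t k) j).2.
have xb j k : (j < r)%N -> bounded_vector (x j k).
  by move=> jr; have [st _ tb] := tP k; apply: tb; rewrite mem_nth ?st.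
have /choice [y yP] (p : nat * 'I_n.+1) :
    exists z, (p.1 < r)%N -> ulim U (fun k => x p.1 k 0 p.2) z.
  case: (ltnP p.1 r) => [jr|]; last by exists 0.
  have [k|z zP] := @bounded_ulim R U UU (fun k => x p.1 k 0 p.2); last by exists z.
  by have [] := xb p.1 k jr.
pose z j : 'rV[C]_n.+1 := \row_i y (j, i).
have xz j : (j < r)%N -> vlim U (x j) (z j) by move=> jr i; rewrite mxE; exact: (yP (j, i)).
have z0 j : (j < r)%N -> exists a, z j 0 a != 0.
  (* The index of the coordinate equal to 1 may vary with [k]; the vanishing of this product is a
     closed condition saying that some coordinate is 1. *)
  move=> jr; suff /eqP/prodf_eq0 [a _] : \prod_i (z j 0 i - 1) = 0.
    rewrite subr_eq0 => /eqP za.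
    by exists a; rewrite za oner_neq0.
  apply: (@ulim_cst_eq _ U UU).
  have : ulim U (fun k => \prod_i (x j k 0 i - 1)) (\prod_i (z j 0 i - 1)).
    by apply: ulim_prod => i; apply: ulimD (xz j jr i) _; exact: ulim_cst.
  congr (ulim U _ _); apply: funext => k; apply/eqP/prodf_eq0.
  by have [_ [i xi]] := xb j k jr; exists i; rewrite ?xi ?subrr.
pose ss := [seq (x j, z j) | j <- iota 0 r].
exists [seq p.2 | p <- ss]; split; first by rewrite !size_map size_iota.
  move=> v /mapP [_ /mapP [j jr ->] -> /=]; have [|a] := z0 j.
    by move: jr; rewrite mem_iota.
  by apply: contraNneq => ->; rewrite mxE.
apply: (killed_ulim UU (g := g)) => // [p|k].
  case/mapP => j; rewrite mem_iota add0n => /= jr -> /=.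
  by split; [exact: xz|exact: z0].
have [st -> tb] := tP k.
have -> : [seq p.1 k | p <- ss] = [seq p.2 | p <- t k].
  by rewrite -[t k in RHS](mkseq_nth (0, 0)) st /ss -!map_comp.
rewrite /power_sum big_seq.
elim/big_rec: _ => [|p q pt kq]; first exact: killed0.
by apply: killedD => //; apply: killed_linform_exp; exact: map_f.
Qed.

Lemma waring_le0 n d r : waring_le (0 : {mpoly C[n]}) d r.
Proof. by exists 0%N; split=> //; exists (fun=> 0); split=> [[]|] //; rewrite big_ord0. Qed.

Lemma border_waring_few_variables U n d r (g : nat -> {mpoly C[n]}) (f : {mpoly C[n]}) :
  UltraFilter U -> (0 < d)%N -> (n <= r)%N -> f \is d.-homog ->
  (forall k, waring_le (g k) d r) -> plim U g f -> waring_le f d (4 ^ r * d).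
Proof.
move=> UU d0; case: n g f => [|n] g f nr fd gr gf.
  suff -> : f = 0 by exact: waring_le0.
  by apply: (dird_eq0 fd d0) => L; rewrite /dird big_ord0.
apply: (spanned_waring_le d0); have [dr|rd] := ltnP d r.
  (* For [d < r] the dimension of the space of forms is at most [2 ^ (d + n)], and
     [d + n <= 2 * r]. *)
  apply: spanned_leq (homog_spanned_bin fd); apply: leq_trans (bin_leq_exp2 _ _) _.
  rewrite (_ : 4 = 2 ^ 2)%N // -expnM -[X in (X <= _)%N]muln1 leq_mul // leq_pexp2l //; lia.
have [s [sr s0 ks]] := border_killed UU d0 gr gf.
have ns : {in [seq normalize v | v <- s], forall v, normalized v}.
  by move=> _ /mapP [v vs ->]; exact/normalize_normalized/s0.
have -> : r = size [seq normalize v | v <- s] by rewrite size_map sr.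
apply: killed_spanned (killed_normalize ks) => //; rewrite ?size_map ?sr //.
- exact: normalized_separated.
- by move=> v /ns /normalized_dot.
Qed.

End BorderRank.

Theorem theorem1 (R : realType) (n d r : nat) (f : {mpoly R[i][n]}) :
  (0 < d)%N -> f \is d.-homog ->
  border_waring_rank f d r ->
  waring_le f d (4 ^ r * d).
Proof.
move=> d0 fd [[g [gr gf]] _].
(* An ultrafilter refining the eventual filter turns ordinary limits into limits along [U]. *)
have [U [UU Uoo]] := ultraFilterLemma eventually_filter.
have gU : plim U g f.
  move=> m eps e0; apply: Uoo; have [N gN] := gf m eps e0.
  by exists N => // k; exact: gN.
(* The bound is proved for [subst Y f], in [rho <= r] variables, and carried back to [f] by
   [subst X]. *)
have [rho [X [Y [rr fE]]]] := essential_variables UU gr fd d0 gU.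
rewrite -fE; apply: waring_le_subst.
apply: (border_waring_few_variables UU (g := fun k => subst Y (g k))) => //.
- exact: subst_homog.
- by move=> k; exact: waring_le_subst.
- by apply: (@subst_plim _ _ _ _ _ d) => // k; exact: (waring_le_homog (gr k)).
Qed.
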